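(* Let $b\in\{2,3,\dots\}$, let $\phi(t)=\min_{z\in\mathbb{Z}}|t-z|$ for $t\in\mathbb{R}$ (the tent map), let $\alpha\in\mathbb{R}$ with $1/b<|\alpha|<1$, and let $f(t)=\sum_{m=0}^\infty\alpha^m\phi(b^mt)$, $t\in[0,1]$. Let $(Y_m)_{m\in\mathbb{N}}$ be the process associated with $\phi$ and $b$ as defined in the context. (a) If $b$ is even, the random variables $(Y_m)_{m\in\mathbb{N}}$ form an i.i.d. sequence of symmetric $\{-1,+1\}$-valued Bernoulli random variables. In particular, for $Z:=\sum_{m=1}^\infty(\alpha b)^{-m}Y_m$, the law of $\widetilde Z:=\alpha bZ$ is the (symmetric) infinite Bernoulli convolution with parameter $1/(|\alpha|b)$, and for $q=-\log_{|\alpha|}b$ we have $$\langle f\rangle_t^{(q)}=t\,(|\alpha|b)^{-q}\,\mathbb{E}[|\widetilde Z|^q],\qquad t\in[0,1].$$ (b) If $b$ is odd, the $(Y_m)_{m\in\mathbb{N}}$ form a (time-homogeneous) Markov chain on $\{-1,0,+1\}$ with initial distribution (law of $Y_1$, states listed in the order $-1,0,+1$) $\left[\frac{b-1}{2b},\frac1b,\frac{b-1}{2b}\right]$ and transition matrix (rows and columns indexed in the order $-1,0,+1$; the row is the current state, the column the next state) $$P=\begin{pmatrix}\frac{b+1}{2b}&0&\frac{b-1}{2b}\\[2pt] \frac{b-1}{2b}&\frac1b&\frac{b-1}{2b}\\[2pt] \frac{b-1}{2b}&0&\frac{b+1}{2b}\end{pmatrix}.$$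
   Context: $\mathbb{N}=\{1,2,\dots\}$. Every function $f$ defined on $[0,1]$ is extended to $[0,\infty)$ by $f(t):=f(\min\{t,1\})$. For $p\ge1$, the $p^{\text{th}}$ variation of $f\in C[0,1]$ along the $b$-adic partitions $\mathbb{T}_n=\{kb^{-n}:k=0,\dots,b^n\}$ is $$\langle f\rangle_t^{(p)}:=\lim_{n\uparrow\infty}\sum_{k=0}^{\lfloor tb^n\rfloor}\big|f((k+1)b^{-n})-f(kb^{-n})\big|^p,\qquad t\in[0,1].$$ Given $\phi$ and $b$, define $$\lambda_{m,k}:=\frac{\phi((k+1)b^{-m})-\phi(kb^{-m})}{b^{-m}},\qquad m\in\mathbb{N},\ k=0,\dots,b^m-1.$$ Let $(\Omega,\mathscr{F},\mathbb{P})$ be a probability space supporting an independent sequence $U_1,U_2,\dots$ of random variables, each uniformly distributed on $\{0,1,\dots,b-1\}$, and define $$R_m:=\sum_{i=1}^mU_ib^{i-1},\qquad Y_m:=\lambda_{m,R_m},\qquad m\in\mathbb{N}.$$ The (symmetric) infinite Bernoulli convolution with parameter $\beta\in(-1,1)$ is the law of $\sum_{m=0}^\infty\beta^m\widetilde Y_m$, where $(\widetilde Y_m)_{m=0,1,\dots}$ is an i.i.d. sequence of $\{-1,+1\}$-valued random variables with a symmetric Bernoulli distribution (each value has probability $1/2$). *)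

(* Defs.v *)
From HB Require Import structures.
From mathcomp Require Import all_boot all_order all_algebra.
From mathcomp Require Import all_classical all_reals all_analysis.
From mathcomp Require Import lra.
Import Order.TTheory GRing.Theory Num.Theory.
Import numFieldNormedType.Exports.
Set Implicit Arguments.
Unset Strict Implicit.
Unset Printing Implicit Defensive.
Local Open Scope classical_set_scope.
Local Open Scope ring_scope.

Section tent.
Context {R : realType}.
Implicit Types t : R.

(* The infimum over the integers is a minimum, see [tent_attained]. *)
Definition tent t : R := inf [set `|t - z%:~R| | z in [set: int]].

Lemma tent_le t (z : int) : tent t <= `|t - z%:~R|.
Proof.
apply: ge_inf; last by exists z.
by exists 0 => _ [y _ <-].
Qed.

Lemma tent_attained t : exists z : int, tent t = `|t - z%:~R|.
Proof.
set h : R := 2^-1.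
have h2 : h + h = 1 by rewrite /h; lra.
exists (Num.floor (t + h)); apply/eqP; rewrite eq_le tent_le /=.
set z0 := Num.floor _.
have lb : z0%:~R <= t + h by exact: floor_le.
have ub : t + h < z0%:~R + 1 by rewrite -intrD1 floorD1_gt.
have lez0 : `|t - z0%:~R| <= h by rewrite ler_norml; apply/andP; split; lra.
apply: lb_le_inf; first by exists `|t - 0%:~R|; exists 0.
move=> _ [z _ <-]; have [-> //|zz0] := eqVneq z z0.
have le1 : 1 <= `|z0%:~R - z%:~R : R|.
  rewrite -intrB -intr_norm -[1]/(1%:~R) ler_int -gtz0_ge1.
  by rewrite normr_gt0 subr_eq0 eq_sym.
have := ler_distD t (z0%:~R : R) z%:~R; rewrite (distrC _ t); lra.
Qed.

End tent.

Section functions.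
Context {R : realType}.
Implicit Types (f phi : R -> R) (b : nat).

Definition weierstrass (alpha : R) b phi (t : R) : R :=
  limn (fun n => \sum_(0 <= m < n) alpha ^+ m * phi (b%:R ^+ m * t)).

Definition extend01 f (t : R) : R := f (Num.min t 1).

Definition variation_sum b f (p t : R) (n : nat) : R :=
  \sum_(0 <= k < (Num.truncn (t * b%:R ^+ n)).+1)
    `|extend01 f (k.+1%:R * b%:R ^- n) - extend01 f (k%:R * b%:R ^- n)| `^ p.

(* The p-th variation of f up to time t exists and equals v. *)
Definition has_variation b f (p t v : R) : Prop :=
  variation_sum b f p t n @[n --> \oo] --> v.

Definition slope phi b (m k : nat) : R :=
  (phi (k.+1%:R * b%:R ^- m) - phi (k%:R * b%:R ^- m)) / b%:R ^- m.

End functions.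

Section processes.
Context {d : measure_display} {T : measurableType d} {R : realType}.
Implicit Types (P : probability T R) (U : nat -> T -> nat).

Definition independent P d' (S : measurableType d') (X : nat -> T -> S) :
    Prop :=
  forall (s : seq nat) (A : nat -> set S), uniq s ->
    (forall i, measurable (A i)) ->
    P (\bigcap_(i in [set` s]) (X i @^-1` A i)) =
    (\prod_(i <- s) P (X i @^-1` A i))%E.

Definition identically_distributed P d' (S : measurableType d')
    (X : nat -> T -> S) : Prop :=
  forall (i j : nat) (A : set S), measurable A ->
    pushforward P (X i) A = pushforward P (X j) A.

Definition iid P d' (S : measurableType d') (X : nat -> T -> S) : Prop :=
  [/\ forall i, measurable_fun setT (X i), independent P X &
      identically_distributed P X].

Definition symmetric_bernoulli P (X : T -> R) : Prop :=
  [/\ forall w, X w = -1 \/ X w = 1,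
      P (X @^-1` [set -1]) = (2^-1)%:E & P (X @^-1` [set 1]) = (2^-1)%:E].

(* As {0, ..., b-1} has total mass 1, V may leave it only on a null set. *)
Definition uniform_digit P b (V : T -> nat) : Prop :=
  forall k : nat, (k < b)%N -> P (V @^-1` [set k]) = (b%:R^-1)%:E.

(* The sequence U_1, U_2, ... is indexed from 0: [U i] stands for U_{i+1}. *)
Definition digit_sum U b (m : nat) (w : T) : nat :=
  (\sum_(i < m) U i w * b ^ i)%N.

Definition slope_process (phi : R -> R) b U (m : nat) (w : T) : R :=
  slope phi b m (digit_sum U b m w).

Definition cond_prob P (A B : set T) : R := fine (P (A `&` B)) / fine (P B).

(* (Time-homogeneous) Markov chain X 0, X 1, ... whose n states are the reals
   [st i]; [nu] is the law of X 0, and [Q i j] is the probability of moving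
   from [st i] to [st j]. *)
Definition markov_chain P (X : nat -> T -> R) n (st : 'I_n -> R)
    (nu : 'rV[R]_n) (Q : 'M[R]_n) : Prop :=
  [/\ forall m, measurable_fun setT (X m),
      forall m w, exists i, X m w = st i,
      forall i, P (X 0%N @^-1` [set st i]) = (nu ord0 i)%:E &
      forall (m : nat) (x : nat -> 'I_n) (j : 'I_n),
        let past := [set w | forall k, (k <= m)%N -> X k w = st (x k)] in
        P past != 0%E ->
        cond_prob P (X m.+1 @^-1` [set st j]) past = Q (x m) j].

End processes.

(* [mu] is the law of \sum_m beta^m Y_m for an i.i.d. symmetric
   {-1, +1}-valued Bernoulli sequence Y, on some probability space. *)
Definition bernoulli_convolution {R : realType} (beta : R)
    (mu : set R -> \bar R) : Prop :=
  -1 < beta < 1 /\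
  exists (d : measure_display) (T : measurableType d) (P : probability T R)
    (Y : nat -> T -> R),
    [/\ iid P Y, forall m, symmetric_bernoulli P (Y m) &
        forall A : set R, measurable A ->
          mu A =
          pushforward P
            (fun w => limn (fun n => \sum_(0 <= m < n) beta ^+ m * Y m w)) A].

Definition tri_state {R : realType} (i : 'I_3) : R :=
  nth 0 [:: -1; 0; 1] i.

Definition init_row {R : realType} (b : nat) : 'rV[R]_3 :=
  \row_j nth 0 [:: (b%:R - 1) / (2 * b%:R); b%:R^-1;
                   (b%:R - 1) / (2 * b%:R)] j.

Definition trans_mx {R : realType} (b : nat) : 'M[R]_3 :=
  \matrix_(i, j) nth 0 (nth [::]
    [:: [:: (b%:R + 1) / (2 * b%:R); 0;       (b%:R - 1) / (2 * b%:R)];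
        [:: (b%:R - 1) / (2 * b%:R); b%:R^-1; (b%:R - 1) / (2 * b%:R)];
        [:: (b%:R - 1) / (2 * b%:R); 0;       (b%:R + 1) / (2 * b%:R)]] i) j.

(* Main.v *)
Require Import Defs.
From HB Require Import structures.
From mathcomp Require Import all_boot all_order all_algebra.
From mathcomp Require Import all_classical all_reals all_analysis.
From mathcomp Require Import zify ring lra.
Import Order.TTheory GRing.Theory Num.Theory.
Import numFieldNormedType.Exports.
Local Open Scope classical_set_scope.
Local Open Scope ring_scope.

(* Everything reduces to a deterministic rule for the slopes. Let X be the slope
   of the tent map on the r-th b^m-adic interval. The next digit u is the leading
   one: the index u b^m + r at level m+1 designates the contracted copy of that
   interval inside [u/b, (u+1)/b]. The tent map is affine there, with slope 1 or
   -1, except if b is odd and u = (b-1)/2: on the middle copy of [0,1] it is, up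
   to a constant, a contraction of the tent map, so that the slope is again X. As
   the digits are independent and uniform, (a) the slopes are i.i.d. signs if b
   is even and (b) they form a Markov chain if b is odd: a prescribed path of
   slopes is, up to a null set, a product event for the digits.

   For the variation, the increment of f over the k-th interval of level n is
   alpha^n z_n(k) with z_n(k) the sum over 1 <= j <= n of (alpha b)^-j times the
   slope of level j at k. Since |alpha|^q = 1/b, the variation sum is an average
   of |z_n|^q. Uniformly in n >= N and k, |z_n|^q is close to |z_N|^q, which is
   b^N-periodic with mean E|Z_N|^q, and E|Z_N|^q tends to E|Z|^q. *)

(** * Slopes of the tent map *)

Section tent_map.
Context {R : realType}.
Implicit Types (x y t : R).

(** An integer nearest to [y] also competes in the infimum defining [tent x]. *)
Lemma tent_lipschitz x y : `|tent x - tent y| <= `|x - y|.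
Proof.
wlog le_yx : x y / tent y <= tent x.
  move=> hwlog; have [/hwlog//|/ltW/hwlog] := leP (tent y) (tent x).
  by rewrite distrC [leRHS]distrC.
rewrite ger0_norm ?subr_ge0//.
have [z ->] := tent_attained y.
by rewrite lerBlDr (le_trans (tent_le x z))// -(subrKA y) ler_normD.
Qed.

Lemma tentD_nat x (n : nat) : tent (x + n%:R) = tent x.
Proof.
apply/eqP; rewrite eq_le; apply/andP; split.
  have [z ->] := tent_attained x.
  apply: (le_trans (tent_le _ (z + n%:Z))).
  by rewrite intrD opprD addrACA subrr addr0.
have [z ->] := tent_attained (x + n%:R).
apply: (le_trans (tent_le _ (z - n%:Z))).
by rewrite intrB opprB addrCA addrC addrAC -addrA.
Qed.

Lemma tent_ge0 x : 0 <= tent x.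
Proof. by have [z ->] := tent_attained x. Qed.

Lemma tent_nat (n : nat) : tent (n%:R : R) = 0.
Proof.
apply/eqP; rewrite eq_le tent_ge0 andbT.
by rewrite (le_trans (tent_le _ n%:Z))// subrr normr0.
Qed.

Lemma tent_increasing t : 0 <= t <= 2^-1 -> tent t = t.
Proof.
move=> /andP[t0 t1]; apply/eqP; rewrite eq_le; apply/andP; split.
  by rewrite (le_trans (tent_le _ 0))// subr0 ger0_norm.
have h2 : (2^-1 + 2^-1 : R) = 1 by lra.
have [z ->] := tent_attained t.
have [z0|z0] := leP z 0.
  have : (z%:~R : R) <= 0 by rewrite lerz0.
  by move=> ?; rewrite ger0_norm; lra.
have : (1 : R) <= z%:~R by rewrite -[1]/(1%:~R) ler_int -gtz0_ge1.
by move=> ?; rewrite ler0_norm; lra.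
Qed.

Lemma tent_decreasing t : 2^-1 <= t <= 1 -> tent t = 1 - t.
Proof.
move=> /andP[t0 t1]; have h2 : (2^-1 + 2^-1 : R) = 1 by lra.
(* The reflection of [z] into [1 - z] permutes the integers, so [t] and [1 - t] have the same tent
   value, and [1 - t] lies on the increasing half. *)
rewrite -[RHS]tent_increasing; last by apply/andP; split; lra.
apply/eqP; rewrite eq_le; apply/andP; split.
  have [z ->] := tent_attained (1 - t).
  rewrite (le_trans (tent_le _ (1 - z)))// intrB -normrN.
  by rewrite (_ : - _ = 1 - t - z%:~R)//; ring.
have [z ->] := tent_attained t.
rewrite (le_trans (tent_le _ (1 - z)))// intrB -normrN.
by rewrite (_ : - (1 - t - _) = t - z%:~R)//; ring.
Qed.

End tent_map.

(* For k < B the tent map has slope [side B k] on [k/B, (k+1)/B]; the value 0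
   occurs when B is odd and 1/2 is the midpoint of that interval. *)
Definition side {R : realType} (B k : nat) : R :=
  if (k.*2.+1 < B)%N then 1 else if (B <= k.*2)%N then -1 else 0.

Section slopes.
Context {R : realType} (b : nat).
Context (b_gt0 : (0 < b)%N).
Local Notation slope := (slope (@tent R) b).

Let B_gt0 m : (0 : R) < b%:R ^+ m.
Proof. by rewrite exprn_gt0// ltr0n. Qed.

(** The tent map has period 1. This allows indices to be reduced below [b ^ m], where [slope_side]
    applies, and makes sums of slopes up to level N periodic in the index. *)
Lemma slopeD m k l : slope m (k + b ^ m * l) = slope m k.
Proof.
rewrite /Defs.slope -addSn !natrD !mulrDl natrM natrX mulrAC mulfV ?gt_eqF//.
by rewrite mul1r !tentD_nat.
Qed.

Lemma slope_mod m k : slope m (k %% b ^ m) = slope m k.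
Proof. by rewrite [in RHS](divn_eq k (b ^ m)) addnC mulnC slopeD. Qed.

Lemma slope_le1 m k : `|slope m k| <= 1.
Proof.
rewrite /Defs.slope normrM normfV.
rewrite ler_pdivrMr ?normr_gt0 ?invr_neq0 ?gt_eqF// mul1r.
rewrite (le_trans (tent_lipschitz _ _))//.
by rewrite -mulrBl -addn1 natrD addrAC subrr add0r mul1r.
Qed.

Lemma slope_side m k : (k < b ^ m)%N -> slope m k = side (b ^ m) k.
Proof.
rewrite /Defs.slope /side; move: (B_gt0 m); rewrite -!natrX.
move: (b ^ m)%N => B Bpos lt_kB.
have h2 : (2^-1 + 2^-1 : R) = 1 by lra.
have Bn : B%:R != 0 :> R by rewrite gt_eqF.
have dbl j : (j%:R / B%:R <= 2^-1 :> R) = (j.*2 <= B)%N.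
  rewrite ler_pdivrMr// -(@ler_nat R) -addnn natrD.
  by apply/idP/idP => ?; lra.
have dbl' j : (2^-1 <= j%:R / B%:R :> R) = (B <= j.*2)%N.
  rewrite ler_pdivlMr// -(@ler_nat R) -addnn natrD.
  by apply/idP/idP => ?; lra.
have ge0 j : (0 <= j%:R / B%:R :> R) by rewrite divr_ge0.
have le1 j : (j <= B)%N -> (j%:R / B%:R <= 1 :> R).
  by move=> ?; rewrite ler_pdivrMr// mul1r ler_nat.
have eS : k.+1%:R / B%:R = k%:R / B%:R + B%:R^-1 :> R.
  by rewrite -addn1 natrD mulrDl mul1r.
case: ifPn => [lt|nlt].
  rewrite !tent_increasing ?dbl ?ge0 //=; last lia.
  by rewrite eS addrAC subrr add0r mulfV// invr_eq0.
case: ifPn => [ge|nge].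
  rewrite !tent_decreasing ?dbl' ?le1 //=; try lia.
  have -> : 1 - k.+1%:R / B%:R - (1 - k%:R / B%:R) = - B%:R^-1 :> R.
    by rewrite eS; ring.
  by rewrite mulNr mulfV ?invr_eq0.
(* Remaining case [B = 2k + 1]: the endpoints are symmetric about 1/2, so the tent values agree. *)
rewrite (@tent_increasing _ (k%:R / _)) ?dbl ?ge0 //=; [|lia].
rewrite tent_decreasing ?dbl' ?le1 //=; [|lia].
rewrite eS (_ : B = k.*2.+1); last lia.
rewrite -addnn -addn1 !natrD.
have ? : 0 < (k%:R + k%:R + 1 : R) by rewrite ltr_wpDl// addr_ge0.
have -> : 1 - (k%:R / (k%:R + k%:R + 1) + (k%:R + k%:R + 1)^-1) -
   k%:R / (k%:R + k%:R + 1) = 0 :> R by field; rewrite gt_eqF.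
by rewrite mul0r.
Qed.

End slopes.

(** * Averages and weighted sums *)

Section powR_lipschitz.
Context {R : realType}.
Implicit Types x y q : R.

Lemma bernoulli_ineq x n : 0 <= x -> 1 - n%:R * (1 - x) <= x ^+ n.
Proof.
move=> x0; elim: n => [|n ih]; first by rewrite mul0r subr0 expr0.
have := ler_wpM2r x0 ih; rewrite -exprSr; apply: le_trans.
rewrite -addn1 natrD.
have := mulr_ge0 (ler0n R n) (sqr_ge0 (1 - x)); nra.
Qed.

(* From Bernoulli's inequality [r ^ q >= r ^ n >= 1 - n (1 - r)] for [r = y / x]. *)
Lemma powR_lipschitz q (C : R) : 1 <= q -> 0 <= C -> exists2 L, 0 <= L &
  forall x y, 0 <= x <= C -> 0 <= y <= C -> `|x `^ q - y `^ q| <= L * `|x - y|.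
Proof.
move=> q1 C0; pose n := (Num.truncn q).+1.
have qn : q <= n%:R by apply/ltW; exact: truncnS_gt.
exists (n%:R * C `^ (q - 1)); first by rewrite mulr_ge0 ?powR_ge0.
move=> x y; wlog yx : x y / y <= x.
  move=> hwlog; have [/hwlog//|/ltW/hwlog h hx hy] := leP y x.
  by rewrite distrC [`|x - y|]distrC h.
move=> /andP[x0 xC] /andP[y0 yC].
have q0 : 0 < q by lra.
have [x0'|xn0] := eqVneq x 0.
  have y0' : y = 0 by lra.
  by rewrite x0' y0' !subrr normr0 mulr0.
have xpos : 0 < x by rewrite lt_def xn0.
rewrite ger0_norm ?subr_ge0 ?ge0_ler_powR ?nnegrE ?(ltW q0)//.
rewrite [leRHS]mulrC ger0_norm ?subr_ge0//.
pose r := y / x; have r0 : 0 <= r by rewrite divr_ge0.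
have r1 : r <= 1 by rewrite ler_pdivrMr// mul1r.
have yE : y = x * r by rewrite /r mulrCA mulfV// mulr1.
have rq : 1 - n%:R * (1 - r) <= r `^ q.
  rewrite (le_trans (bernoulli_ineq r n r0))//.
  have [->|rn0] := eqVneq r 0; first by rewrite expr0n/= powR_ge0.
  by rewrite -powR_mulrn// ger_powR// r1 andbT lt_def rn0.
(* With [y = x * r] the difference is [x^(q-1) * x * (1 - r^q)], at most [C^(q-1) * n * (x - y)]. *)
rewrite yE powRM// -{1}[x `^ q]mulr1 -mulrBr -mulr_powRB1//.
rewrite (_ : (x - x * r) * _ = x * (n%:R * (1 - r)) * C `^ (q - 1)); last by ring.
rewrite mulrAC ler_pM ?mulr_ge0 ?powR_ge0 ?subr_ge0//.
- rewrite -[leRHS](congr1 (fun g => g q) (@powR1 R)) ge0_ler_powR ?nnegrE//; lra.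
- by rewrite ler_wpM2l//; lra.
- by rewrite ge0_ler_powR ?nnegrE//; lra.
Qed.

End powR_lipschitz.

Section geometric_weights.
Context {R : realType}.
Implicit Types (a : R) (s : nat -> R).

Definition weighted_sum a s n : R := \sum_(1 <= j < n.+1) a ^- j * s j.

(** For [|a| > 1], the sum of [|a|^-j] over [j >= n]; it includes the term [j = n], one more than
    the tail of [weighted_sum] after [n]. *)
Definition tail_bound a n : R := `|a|^-1 ^+ n / (1 - `|a|^-1).

Lemma eq_weighted_sum a s s' n :
  (forall j, (j <= n)%N -> s j = s' j) -> weighted_sum a s n = weighted_sum a s' n.
Proof.
by move=> ss'; apply: eq_big_nat => j /andP[_ jn]; rewrite ss'.
Qed.

Lemma inv_norm_lt1 a : 1 < `|a| -> 0 < `|a|^-1 < 1.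
Proof.
by move=> a1; have a0 := lt_trans ltr01 a1; rewrite invr_gt0 a0 invf_lt1.
Qed.

Lemma tail_bound_ge0 a n : 1 < `|a| -> 0 <= tail_bound a n.
Proof.
by move=> /inv_norm_lt1/andP[r0 r1]; rewrite divr_ge0 ?exprn_ge0 ?subr_ge0 ?ltW.
Qed.

Lemma cvg_tail_bound a : 1 < `|a| -> tail_bound a n @[n --> \oo] --> 0.
Proof.
move=> /inv_norm_lt1/andP[r0 r1]; rewrite -[0](mul0r (1 - `|a|^-1)^-1).
apply: cvgM; last exact: cvg_cst.
by apply: cvg_expr; rewrite ger0_norm ?ltW.
Qed.

Lemma weighted_sum_tail a s n N : 1 < `|a| -> (forall j, `|s j| <= 1) ->
  (N <= n)%N -> `|weighted_sum a s n - weighted_sum a s N| <= tail_bound a N.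
Proof.
move=> a1 s1; have /andP[r0 r1] := inv_norm_lt1 _ a1.
(* The sharper bound makes the induction telescope: from [n] to [n + 1] the tail bound drops by
   [|a|^-n], which dominates the new term of size at most [|a|^-(n+1)]. *)
move=> Nn; apply: (@le_trans _ _ (tail_bound a N - tail_bound a n)); last first.
  by rewrite gerBl tail_bound_ge0.
rewrite -(subnKC Nn); elim: (n - N)%N => [|m ih].
  by rewrite addn0 !subrr normr0.
rewrite addnS {1}/weighted_sum big_nat_recr//= -/(weighted_sum a s (N + m)).
rewrite addrAC (le_trans (ler_normD _ _))//.
rewrite -[leRHS](subrKA (tail_bound a (N + m))) lerD//.
have -> : tail_bound a (N + m) - tail_bound a (N + m).+1 = `|a|^-1 ^+ (N + m).
  rewrite /tail_bound exprS -mulrBl -{1}[_ ^+ _]mul1r -mulrBl mulrAC mulfV ?mul1r//.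
  by rewrite subr_eq0 gt_eqF.
have rge0 k : 0 <= `|a|^-1 ^+ k by rewrite exprn_ge0 ?ltW.
rewrite normrM normfV normrX -exprVn (le_trans (ler_piMr (rge0 _) (s1 _)))//.
by rewrite exprS ler_piMl ?exprn_ge0 ?ltW.
Qed.

Lemma is_cvg_weighted_sum a s : 1 < `|a| -> (forall j, `|s j| <= 1) ->
  cvgn (weighted_sum a s).
Proof.
move=> a1 s1; apply: cauchy_cvg; apply: cauchy_exP => e e0.
have [N _ hN] := cvgr_lt _ (cvg_tail_bound a a1) _ e0.
exists (weighted_sum a s N), N => // n /= Nn.
rewrite /ball/= distrC (le_lt_trans (weighted_sum_tail a s n N a1 s1 Nn))//.
exact: hN (leqnn N).
Qed.

Lemma weighted_sum_lim a s N : 1 < `|a| -> (forall j, `|s j| <= 1) ->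
  `|limn (weighted_sum a s) - weighted_sum a s N| <= tail_bound a N.
Proof.
move=> a1 s1; have cs := is_cvg_weighted_sum a s a1 s1.
have cd : `|weighted_sum a s n - weighted_sum a s N| @[n --> \oo] -->
    `|limn (weighted_sum a s) - weighted_sum a s N|.
  by apply: cvg_norm; apply: cvgB => //; exact: cvg_cst.
rewrite -(cvg_lim _ cd)//; apply: limr_le; first by apply/cvg_ex; eexists; exact: cd.
by exists N => // n /= Nn; exact: weighted_sum_tail.
Qed.

Lemma weighted_sum_bound a s n : 1 < `|a| -> (forall j, `|s j| <= 1) ->
  `|weighted_sum a s n| <= tail_bound a 0.
Proof.
move=> a1 s1; rewrite -[weighted_sum a s n]subr0.
rewrite -[X in _ - X](_ : weighted_sum a s 0 = 0) ?weighted_sum_tail//.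
by rewrite /weighted_sum big_geq.
Qed.

End geometric_weights.

Section periodic_average.
Context {R : realType}.

(** Complete periods contribute exactly their share; only the last, incomplete one errs, by at most
    [M + |e|] for each of its fewer than [B] terms. *)
Lemma periodic_sum (F : nat -> R) (B : nat) (e M : R) : (0 < B)%N ->
  (forall k, F (k + B)%N = F k) -> (forall k, `|F k| <= M) ->
  \sum_(0 <= k < B) F k = B%:R * e ->
  forall n, `|\sum_(0 <= k < n) F k - n%:R * e| <= B%:R * (M + `|e|).
Proof.
move=> B0 FB FM FE n.
have M0 : 0 <= M + `|e| by rewrite addr_ge0// (le_trans _ (FM 0)).
rewrite (divn_eq n B); elim: (n %/ B)%N => [|l ih].
  rewrite mul0n add0n; apply: (@le_trans _ _ ((n %% B)%:R * (M + `|e|))).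
    rewrite mulrDr (le_trans (ler_normB _ _))// normrM normr_nat lerD2r.
    rewrite (le_trans (ler_norm_sum _ _ _))//.
    rewrite (le_trans (ler_sum _ (fun k _ => FM k)))//.
    by rewrite sumr_const_nat subn0 mulr_natl.
  by rewrite ler_wpM2r// ler_nat ltnW// ltn_mod.
rewrite mulSn -addnA (big_cat_nat (n := B)) ?leq_addr//= FE.
rewrite -{2}[B]add0n [(B + _)%N]addnC big_addn addnK.
rewrite (eq_bigr F) => [|k _]; last by rewrite FB.
by rewrite natrD mulrDl [X in `|_ - X|]addrC [X in `|X - _|]addrC addrKA.
Qed.

(** Fix [N] with [delta N] small and replace every [F n] by the periodic [F N], at cost [delta N]
    per term. The sum of [F N] is controlled by [periodic_sum] with an error independent of [n],
    which vanishes after division by [B n]. *)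
Lemma cvg_average (B : nat -> nat) (F : nat -> nat -> R) (M : R)
    (delta e : nat -> R) (E t : R) (m : nat -> nat) :
    (forall n, (0 < B n)%N) ->
    (B n)%:R^-1 @[n --> \oo] --> (0 : R) ->
    (forall N k, F N (k + B N)%N = F N k) ->
    (forall N k, `|F N k| <= M) ->
    (forall N n k, (N <= n)%N -> `|F n k - F N k| <= delta N) ->
    delta N @[N --> \oo] --> (0 : R) ->
    (forall N, \sum_(0 <= k < B N) F N k = (B N)%:R * e N) ->
    (forall N, `|e N - E| <= delta N) ->
    0 <= t <= 1 ->
    (forall n, `|(m n)%:R - t * (B n)%:R| <= 1) ->
  (B n)%:R^-1 * \sum_(0 <= k < m n) F n k @[n --> \oo] --> t * E.
Proof.
move=> B0 Boo FB FM Fd d0 Fe eE /andP[t0 t1] mB.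
have Bp n : 0 < (B n)%:R :> R by rewrite ltr0n.
apply/cvgrPdist_lt => eps eps0.
have e8 : 0 < eps / 8 by lra.
have [N _ /(_ N (leqnn N))/= dN] := cvgr_lt _ d0 _ e8.
have dN0 : 0 <= delta N by apply: le_trans (eE N).
(* The errors that do not grow with [n]: the incomplete period, and the rounding of [t * B n] to
   [m n]. *)
pose c := (B N)%:R * (M + `|e N|) + `|e N|.
have e2 : 0 < eps / 2 by lra.
have cB : c * (B n)%:R^-1 @[n --> \oo] --> (0 : R).
  by rewrite -[0](mulr0 c); apply: cvgM => //; exact: cvg_cst.
have [n0 _ hn0] := cvgr_lt _ cB _ e2.
exists (maxn N n0) => // n /=; rewrite geq_max => /andP[Nn n0n].
have {n0n} /= cn := hn0 n n0n.
have s1 : `|\sum_(0 <= k < m n) F n k - \sum_(0 <= k < m n) F N k| <=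
    (m n)%:R * delta N.
  rewrite -sumrB (le_trans (ler_norm_sum _ _ _))//.
  rewrite (le_trans (ler_sum _ (fun k _ => Fd N n k Nn)))//.
  by rewrite sumr_const_nat subn0 mulr_natl.
have s2 := periodic_sum (F N) (B N) (e N) M (B0 N) (FB N) (FM N) (Fe N) (m n).
have s3 : `|(m n)%:R * e N - t * (B n)%:R * e N| <= `|e N|.
  by rewrite -mulrBl normrM ler_piMl.
have s4 : `|t * (B n)%:R * e N - t * (B n)%:R * E| <= (B n)%:R * delta N.
  rewrite -mulrBr normrM ler_pM// normrM !ger0_norm ?ler_piMl//; exact: ltW.
have m2 : (m n)%:R <= 2 * (B n)%:R :> R.
  have : 1 <= (B n)%:R :> R by rewrite ler1n.
  have := mB n; rewrite ler_norml => /andP[_].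
  have : t * (B n)%:R <= (B n)%:R by rewrite ler_piMl// ltW.
  lra.
(* Of the factor 3, [s1] contributes 2, as [m n <= 2 * B n], and [s4] contributes 1. After division
   by [B n] the total is below [eps / 2 + 3 * eps / 8]. *)
have s : `|t * (B n)%:R * E - \sum_(0 <= k < m n) F n k| <= c + 3 * (B n)%:R * delta N.
  have := ler_wpM2r dN0 m2; move: s1 s2 s3 s4; rewrite /c !ler_norml.
  move=> /andP[? ?] /andP[? ?] /andP[? ?] /andP[? ?] ?; apply/andP; split; lra.
have -> : t * E - (B n)%:R^-1 * \sum_(0 <= k < m n) F n k =
  (B n)%:R^-1 * (t * (B n)%:R * E - \sum_(0 <= k < m n) F n k).
  by field; rewrite gt_eqF.
rewrite normrM normfV normr_nat mulrC ltr_pdivrMr//.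
move: cn; rewrite ltr_pdivrMr// => cn.
apply: (le_lt_trans s).
have := ler_wpM2l (ltW (Bp n)) (ltW dN); have := mulr_gt0 (Bp n) eps0; lra.
Qed.

End periodic_average.

(** * Variation of the Weierstrass-type function *)

Section weierstrass_variation.
Context {R : realType} (b : nat) (alpha : R).
Context (b_ge2 : (2 <= b)%N) (alpha_bounds : b%:R^-1 < `|alpha| < 1).
Local Notation a := (alpha * b%:R).
Local Notation slope := (slope (@tent R) b).
Local Notation f := (weierstrass alpha b (@tent R)).
Local Notation q := (- (ln b%:R / ln `|alpha|)).

Let b_gt0 : (0 < b)%N. Proof. exact: ltnW. Qed.
Let bR_gt0 : (0 : R) < b%:R. Proof. by rewrite ltr0n. Qed.
Let alpha_gt0 : 0 < `|alpha|.
Proof. by case/andP: alpha_bounds => + _; apply: lt_trans; rewrite invr_gt0. Qed.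

Lemma scale_gt1 : 1 < `|a|.
Proof.
case/andP: alpha_bounds => h _.
by rewrite normrM normr_nat -ltr_pdivrMr// mul1r.
Qed.

Lemma ln_alpha_lt0 : ln `|alpha| < 0.
Proof. by case/andP: alpha_bounds => _ h; rewrite ln_lt0// alpha_gt0. Qed.

(** The logarithm of [b^-1 < |alpha|]. It makes [powR_lipschitz] applicable to the exponent [q]. *)
Lemma variation_exponent_ge1 : 1 <= q.
Proof.
have l0 := ln_alpha_lt0.
rewrite -mulrN -invrN ler_pdivlMr ?oppr_gt0// mul1r lerNl -lnV ?posrE//.
by rewrite ler_ln ?posrE ?invr_gt0// ltW//; case/andP: alpha_bounds.
Qed.

Lemma powR_alpha : `|alpha| `^ q = b%:R^-1.
Proof.
rewrite /powR gt_eqF// mulNr mulfVK ?lt_eqF ?ln_alpha_lt0//.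
by rewrite expRN lnK ?posrE.
Qed.

(** From [m = n] on, the tent map is evaluated at integers, so the partial sums are eventually
    constant. *)
Lemma weierstrass_adic n k :
  f (k%:R * b%:R ^- n) =
  \sum_(0 <= m < n) alpha ^+ m * tent (b%:R ^+ m * (k%:R * b%:R ^- n)).
Proof.
apply: lim_near_cst => //; exists n => // N /= nN.
rewrite (big_cat_nat (n := n))//= [X in _ + X]big1_seq ?addr0// => m.
rewrite mem_index_iota => /andP[_ /andP[nm _]].
rewrite mulrCA -expfB_cond ?(subnKC nm)//; last by rewrite pnatr_eq0; lia.
by rewrite -natrX -natrM tent_nat mulr0.
Qed.

Lemma weierstrass_increment n k :
  f (k.+1%:R * b%:R ^- n) - f (k%:R * b%:R ^- n) =
  alpha ^+ n * weighted_sum a (slope^~ k) n.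
Proof.
rewrite !weierstrass_adic -sumrB /weighted_sum big_add1/= mulr_sumr.
(* Term [m] of the series sees an interval of length [b^(m-n)], hence a slope of level [n - m]; the
   reversal sorts the terms by that level. *)
rewrite big_nat_rev/= add0n; apply: eq_big_nat => m /andP[_ mn].
have alpha0 : alpha != 0 by rewrite -normr_gt0.
have b0 : b%:R != 0 :> R by rewrite gt_eqF.
have -> : n = ((n - m.+1) + m.+1)%N by rewrite subnK.
move: (n - m.+1)%N => j; rewrite addnK /Defs.slope.
have E i : b%:R ^+ j * (i%:R * b%:R ^- (j + m.+1)) = i%:R * b%:R ^- m.+1 :> R.
  by rewrite exprD; field; rewrite !expf_neq0.
rewrite !E -mulrBr exprD exprMn; field.
by rewrite !expf_neq0.
Qed.

Lemma has_variation_weierstrass (e : nat -> R) (E : R) (t : R) :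
    (forall N, \sum_(0 <= k < b ^ N) `|weighted_sum a (slope^~ k) N| `^ q =
       (b ^ N)%:R * e N) ->
    (exists2 L, 0 <= L & forall N, `|e N - E| <= L * tail_bound a N) ->
  0 <= t <= 1 -> has_variation b f q t (t * E).
Proof.
move=> eE [L0 L0_ge0 hL0] t01; have a1 := scale_gt1.
have q1 := variation_exponent_ge1; have q0 : 0 < q by lra.
have [L1 L1_ge0 hL1] := powR_lipschitz q (tail_bound a 0) q1 (tail_bound_ge0 _ _ a1).
pose F N k := `|weighted_sum a (slope^~ k) N| `^ q.
(* For [t = 1] the variation sum has the extra index [b ^ n], whose interval starts at 1, where
   [extend01 f] is constant. Cutting at [b ^ n] drops this zero term. *)
pose m n := minn (Num.truncn (t * b%:R ^+ n)).+1 (b ^ n).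
have bX n : 0 < b%:R ^+ n :> R by rewrite exprn_gt0.
have wb N k : 0 <= `|weighted_sum a (slope^~ k) N| <= tail_bound a 0.
  by rewrite normr_ge0/= weighted_sum_bound// => j; exact: slope_le1.
have truncP n : (Num.truncn (t * b%:R ^+ n))%:R <= t * b%:R ^+ n <
    (Num.truncn (t * b%:R ^+ n)).+1%:R.
  by apply: truncn_itv; rewrite mulr_ge0//; case/andP: t01.
rewrite /has_variation.
have -> : variation_sum b f q t =
    fun n => (b ^ n)%:R^-1 * \sum_(0 <= k < m n) F n k.
  apply/funext => n; rewrite /variation_sum.
  rewrite (big_cat_nat (n := m n))//=; last exact: geq_minl.
  rewrite [X in _ + X]big1_seq ?addr0 => [|k]; last first.
    rewrite mem_index_iota => /andP[_ /andP[mk kt]].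
    have {}mk : (b ^ n <= k)%N by move: mk kt; rewrite /m; lia.
    have one i : (b ^ n <= i)%N -> extend01 f (i%:R * b%:R ^- n) = f 1.
      move=> bi; rewrite /extend01 min_r// ler_pdivlMr// mul1r -natrX ler_nat//.
    by rewrite !one ?(leq_trans mk)// subrr normr0 powR0// gt_eqF.
  rewrite mulr_sumr; apply: eq_big_nat => k /andP[_ km].
  have {}km : (k < b ^ n)%N by rewrite (leq_trans km)// geq_minr.
  have in01 i : (i <= b ^ n)%N -> extend01 f (i%:R * b%:R ^- n) = f (i%:R * b%:R ^- n).
    by move=> bi; rewrite /extend01 min_l// ler_pdivrMr// mul1r -natrX ler_nat.
  rewrite !in01 ?(ltnW km)// weierstrass_increment normrM powRM// normrX.
  congr (_ * _); rewrite -powR_mulrn// -powRrM mulrC powRrM powR_alpha.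
  by rewrite powR_mulrn ?invr_ge0// natrX exprVn.
(* In [cvg_average] a single [delta] bounds both the change of [F] between levels and the distance
   from [e] to [E]. *)
pose L := Num.max L0 L1.
apply: (cvg_average (fun n => b ^ n)%N F (tail_bound a 0 `^ q)
  (fun N => L * tail_bound a N) e) => //.
- by move=> n; rewrite expn_gt0 b_gt0.
- under eq_fun do rewrite natrX -exprVn.
  apply: cvg_expr; rewrite ger0_norm ?invr_ge0// invf_lt1// ltr1n//.
- move=> N k; congr (`|_| `^ _); apply: eq_weighted_sum => j jN.
  by rewrite -(subnKC jN) expnD slopeD.
- move=> N k; have /andP[_ wt] := wb N k; rewrite ger0_norm ?powR_ge0//.
  by apply: ge0_ler_powR; rewrite ?nnegrE ?tail_bound_ge0// ltW.
- move=> N n k Nn; apply: (le_trans (hL1 _ _ (wb n k) (wb N k))).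
  rewrite ler_pM ?le_max ?lexx ?orbT//.
  rewrite (le_trans (ler_dist_dist _ _))// weighted_sum_tail// => j.
  exact: slope_le1.
- by rewrite -[0](mulr0 L); apply: cvgM; [exact: cvg_cst|exact: cvg_tail_bound].
- move=> N; rewrite (le_trans (hL0 N))// ler_wpM2r ?tail_bound_ge0//.
  by rewrite le_max lexx.
- move=> n; have /andP[tl tu] := truncP n.
  have ? : t * b%:R ^+ n <= b%:R ^+ n.
    by rewrite ler_piMl ?(ltW (bX n))//; case/andP: t01.
  rewrite natrX /m /minn; case: ifPn => h; rewrite ler_norml.
    by move: tu; rewrite -addn1 natrD => ?; apply/andP; split; lra.
  have : (b ^ n)%:R <= (Num.truncn (t * b%:R ^+ n)).+1%:R :> R.
    by rewrite ler_nat leqNgt.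
  by rewrite natrX -addn1 natrD => ?; apply/andP; split; lra.
Qed.

End weierstrass_variation.

(** * Uniform digits *)

Section digits.
Local Open Scope nat_scope.
Context {d : measure_display} {T : measurableType d}.
Context (U : nat -> T -> nat) (b : nat) (w : T).
Context (b_gt0 : 0 < b).
Local Notation R_ m := (digit_sum U b m w).

Lemma digit_sumS m : R_ m.+1 = U m w * b ^ m + R_ m.
Proof. by rewrite /digit_sum big_ord_recr/= addnC. Qed.

Lemma digit_sum_modn m n : m <= n -> R_ n = R_ m %[mod b ^ m].
Proof.
move=> mn; rewrite -(subnKC mn); elim: (n - m) => [|j ih]; first by rewrite addn0.
by rewrite addnS digit_sumS expnD mulnA mulnAC modnMDl.
Qed.

Context (U_lt : forall i, U i w < b).

Lemma digit_sum_lt m : R_ m < b ^ m.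
Proof.
elim: m => [|m ih]; first by rewrite /digit_sum big_ord0.
rewrite digit_sumS expnS; have := leq_mul (U_lt m) (leqnn (b ^ m)); lia.
Qed.

(** Uniqueness of the base [b] expansion. It turns an event on the digit sum into a product event
    for the digits. *)
Lemma digit_sum_eqP m k :
  R_ m = k %% b ^ m <-> forall i, i < m -> U i w = k %/ b ^ i %% b.
Proof.
have B_gt0 i : 0 < b ^ i by rewrite expn_gt0 b_gt0.
split=> [Rk i im|Uk].
  rewrite modn_divl -expnS -(modn_dvdm _ (dvdn_exp2l b im)) -Rk.
  rewrite (digit_sum_modn _ _ im) (modn_small (digit_sum_lt _)) digit_sumS.
  by rewrite divnMDl// divn_small ?addn0// digit_sum_lt.
elim: m Uk => [|m ih] Uk; first by rewrite /digit_sum big_ord0 expn0 modn1.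
rewrite digit_sumS ih => [|i im]; last by rewrite Uk// ltnW.
rewrite Uk// modn_divl -expnS [RHS](divn_eq _ (b ^ m)).
by rewrite modn_dvdm// dvdn_exp2l.
Qed.

End digits.

Section bounded_random_variables.
Context {d : measure_display} {T : measurableType d} {R : realType}.
Context (P : probability T R).

Lemma measurable_nat_fun d' (S : measurableType d') (f : nat -> S) :
  measurable_fun setT f.
Proof. by []. Qed.

Lemma Rintegral_dist_le (f g : T -> R) (c : R) :
  P.-integrable setT (EFin \o f) -> P.-integrable setT (EFin \o g) ->
  (forall w, `|f w - g w| <= c) -> `|\int[P]_w f w - \int[P]_w g w| <= c.
Proof.
move=> fi gi fg; rewrite -RintegralB//.
have fgi : P.-integrable setT (EFin \o (fun w => f w - g w)).
  by exact: (integrableB measurableT fi gi).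
rewrite (le_trans (le_normr_Rintegral _ fgi))//.
have ci : P.-integrable setT (EFin \o (fun=> c)).
  by exact: finite_measure_integrable_cst.
rewrite (le_trans (le_Rintegral _ _ ci _))//; first exact: integrable_norm.
by rewrite Rintegral_cst// [X in fine X]probability_setT mulr1.
Qed.

Lemma bounded_integrable (f : T -> R) (c : R) : measurable_fun setT f ->
  (forall w, `|f w| <= c) -> P.-integrable setT (EFin \o f).
Proof.
move=> mf fc; apply: measurable_bounded_integrable => //.
  by rewrite [X in (X < _)%E]probability_setT ltry.
exists c; split; first exact: num_real.
by move=> x cx w _; exact: (le_trans (fc w) (ltW cx)).
Qed.

End bounded_random_variables.

Section uniform_digits.
Context {d : measure_display} {T : measurableType d} {R : realType}.
Context (P : probability T R) (b : nat) (U : nat -> {RV P >-> nat}).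
Context (b_gt0 : (0 < b)%N).
Context (U_indep : independent P (fun i => U i : T -> nat)).
Context (U_unif : forall i, uniform_digit P b (U i)).
Local Notation digit_sum m := (digit_sum (fun i => U i : T -> nat) b m).

Let measurable_preU i A : measurable (U i @^-1` A).
Proof. by rewrite -[_ @^-1` _]setTI; exact: (measurable_funPT (U i)). Qed.

Lemma prob_digit_seq i (s : seq nat) : uniq s -> all (fun k => k < b)%N s ->
  P (U i @^-1` [set` s]) = ((size s)%:R / b%:R)%:E.
Proof.
elim: s => [_ _|k s ih /= /andP[ks us] /andP[kb sb]].
  by rewrite classical_sets.set_nil preimage_set0 measure0 mul0r.
have -> : [set` k :: s] = [set k] `|` [set` s].
  by apply/seteqP; split=> j /=; rewrite inE => /predU1P.
rewrite preimage_setU measureU//; last first.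
  by apply/seteqP; split=> // w [/= -> kin]; move: ks; rewrite kin.
rewrite [X in (X + _)%E](U_unif i k kb) [X in (_ + X)%E](ih us sb).
by rewrite -EFinD -addn1 natrD mulrDl mul1r addrC.
Qed.

(** The [b] admissible values already carry mass [b * b^-1 = 1]. *)
Lemma ae_digit_lt : {ae P, forall w, forall i, (U i w < b)%N}.
Proof.
apply: ae_foralln => i; exists (~` (U i @^-1` [set` iota 0 b])).
split; first exact: measurableC.
- rewrite [LHS](probability_setC P)// prob_digit_seq ?iota_uniq//.
    by rewrite size_iota mulfV ?subee// pnatr_eq0 -lt0n.
  by apply/allP => k; rewrite mem_iota.
- by move=> w /=; apply: contra_not; rewrite mem_iota.
Qed.

(** Allows events to be compared only where all digits are admissible, which is where the arithmetic
    of digit sums is valid. *)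
Lemma eq_prob_digits (A B : set T) : measurable A -> measurable B ->
  (forall w, (forall i, (U i w < b)%N) -> A w <-> B w) -> P A = P B.
Proof.
move=> mA mB AB; have [N [mN PN0 hN]] := ae_digit_lt.
have PD C : measurable C -> P C = P (C `\` N).
  move=> mC; rewrite [LHS](measureDI _ mC mN) [X in (_ + X)%E](_ : _ = 0%E) ?adde0//.
  by apply: (subset_measure0 _ mN) => //; exact: measurableI.
rewrite PD// [RHS]PD//; congr (P _); apply/seteqP.
by split=> w [? Nw]; split=> //; apply/AB => //; apply: contrapT => /hN.
Qed.

Lemma prob_digit i (D : pred nat) :
  P (U i @^-1` [set k | D k]) = ((count D (iota 0 b))%:R / b%:R)%:E.
Proof.
rewrite -size_filter -(prob_digit_seq i) ?filter_uniq ?iota_uniq//; last first.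
  by apply/allP => k; rewrite mem_filter mem_iota => /and3P[].
apply: eq_prob_digits => // w Uw /=.
by rewrite mem_filter mem_iota Uw leq0n !andbT.
Qed.

Lemma prob_digits n (D : nat -> set nat) :
  P (\bigcap_(i < n) (U i @^-1` D i)) = (\prod_(i < n) P (U i @^-1` D i))%E.
Proof.
have := U_indep (iota 0 n) D (iota_uniq 0 n) (fun=> I).
rewrite -(big_mkord xpredT (fun i => P (U i @^-1` D i))) /index_iota subn0 => <-.
congr (P _); apply/seteqP.
by split=> w h i hi; apply: h; move: hi; rewrite /= mem_iota.
Qed.

Lemma measurable_digit_sum m : measurable_fun setT (digit_sum m).
Proof.
elim: m => [|m ih].
  rewrite (_ : digit_sum 0 = cst 0%N)//; apply/funext => w.
  by rewrite /Defs.digit_sum big_ord0.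
rewrite (_ : digit_sum m.+1 = fun w => (U m w * b ^ m + digit_sum m w)%N).
  apply: measurable_realfun.measurable_fun_addn => //.
  exact: (measurableT_comp (measurable_nat_fun _ _ (fun k => k * b ^ m)%N)).
by apply/funext => w; exact: digit_sumS.
Qed.

Lemma prob_digit_sum m k : (k < b ^ m)%N ->
  P [set w | (digit_sum m w %% b ^ m = k)%N] = ((b ^ m)%:R^-1)%:E.
Proof.
move=> km.
rewrite (@eq_prob_digits _ (\bigcap_(i < m) (U i @^-1` [set (k %/ b ^ i %% b)%N]))).
- rewrite prob_digits (eq_bigr (fun=> (b%:R^-1)%:E)) => [|i _]; last first.
    by apply: U_unif; rewrite ltn_mod.
  rewrite prodEFin prodr_const card_ord natrX exprVn//.
- have := measurable_digit_sum m; move=> /(_ measurableT [set j | (j %% b ^ m = k)%N]).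
  by rewrite setTI; apply.
- by apply: bigcap_measurableType => // i _.
- move=> w Uw /=; rewrite (modn_small (digit_sum_lt _ _ _ b_gt0 Uw m)).
  rewrite -{1}(modn_small km) digit_sum_eqP//.
Qed.

Lemma Rintegral_digit_sum m (F : nat -> R) :
  (forall k, F (k %% b ^ m)%N = F k) ->
  \sum_(0 <= k < b ^ m) F k = (b ^ m)%:R * \int[P]_w F (digit_sum m w).
Proof.
move=> Fmod.
(* Owing to the reduction modulo [b ^ m], these events partition the whole space, including the null
   set where a digit is too large. *)
pose A k := [set w | (digit_sum m w %% b ^ m = k)%N].
have mA k : measurable (A k).
  have := measurable_digit_sum m; move=> /(_ measurableT [set j | (j %% b ^ m = k)%N]).
  by rewrite setTI; apply.
have iA k : P.-integrable setT (EFin \o (fun w => F k * \1_(A k) w)).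
  apply: (bounded_integrable _ _ `|F k|).
    exact: measurable_realfun.measurable_funM.
  move=> w; rewrite normrM ler_piMr// indicE.
  by case: (_ \in _); rewrite ?normr1// normr0.
pose S n w := \sum_(0 <= k < n) F k * \1_(A k) w.
have S0 : S 0%N = fun=> 0 by apply/funext => w; rewrite /S big_geq.
have SS n : S n.+1 = fun w => S n w + F n * \1_(A n) w.
  by apply/funext => w; rewrite /S big_nat_recr.
have E n : (n <= b ^ m)%N -> P.-integrable setT (EFin \o S n) /\
    (b ^ m)%:R * \int[P]_w S n w = \sum_(0 <= k < n) F k.
  elim: n => [_|n ih nb].
    rewrite S0 Rintegral_cst// mul0r mulr0 big_geq//; split => //.
    exact: finite_measure_integrable_cst.
  have [iS ES] := ih (ltnW nb); rewrite SS.
  split; first exact: (integrableD measurableT iS (iA n)).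
  rewrite RintegralD// mulrDr ES big_nat_recr//=; congr (_ + _).
  rewrite RintegralZl//; last first.
    apply: (bounded_integrable _ _ 1) => // w; rewrite indicE.
    by case: (_ \in _); rewrite ?normr1// normr0.
  rewrite /Rintegral integral_indic// setIT.
  rewrite [X in fine X](prob_digit_sum m n nb)/= mulrCA mulfV ?mulr1//.
  by rewrite pnatr_eq0 expn_eq0; lia.
have [_ <-] := E _ (leqnn _); congr (_ * _); apply: eq_Rintegral => w _; rewrite /S.
have B_gt0 : (0 < b ^ m)%N by rewrite expn_gt0 b_gt0.
rewrite big_mkord (bigD1 (Ordinal (ltn_pmod (digit_sum m w) B_gt0)))//=.
rewrite indicE mem_set// mulr1 Fmod big1 ?addr0// => k /eqP kw.
rewrite indicE memNset ?mulr0// => wk; apply: kw; apply: val_inj => /=.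
by rewrite -wk.
Qed.

End uniform_digits.

(** * Slopes as functions of the digits *)

(* The slope with index [u * B + r] at the level following [B], when [b] is odd
   and [x] is the slope with index [r]; see [side_odd]. *)
Definition refine_slope {R : realType} (b u : nat) (x : R) : R :=
  if (u < b./2)%N then 1 else if (b./2 < u)%N then -1 else x.

Section refinement.
Context {R : realType} (b : nat).

(** For even [b] the point 1/2 separates two of the [b] copies, so that the leading digit [u] alone
    decides the side. *)
Lemma side_even (B u r : nat) : ~~ odd b -> (r < B)%N ->
  side (b * B) (u * B + r) = (if (u < b./2)%N then 1 else -1) :> R.
Proof.
move=> ob rB; have bE : b = (b./2 * 2)%N by rewrite muln2 even_halfK.
rewrite /side [in (b * B)%N]bE; case: (ltnP u b./2) => h.
  by rewrite ifT//; have := leq_mul h (leqnn B); lia.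
have := leq_mul h (leqnn B) => ?.
by rewrite ifF; [rewrite ifT//; lia|lia].
Qed.

Lemma side_odd (B u r : nat) : odd b -> (r < B)%N ->
  side (b * B) (u * B + r) = refine_slope b u (side B r) :> R.
Proof.
move=> ob rB; have bE : b = (b./2 * 2 + 1)%N.
  by rewrite -{1}(odd_double_half b) ob -muln2; lia.
rewrite /side /refine_slope [in (b * B)%N]bE.
move: (b./2) => c.
case: (ltngtP u c) => h.
- by rewrite ifT//; have := leq_mul h (leqnn B); lia.
- have := leq_mul h (leqnn B) => ?.
  by rewrite ifF; [rewrite ifT//; lia|lia].
- subst u.
  have -> : ((c * B + r).*2.+1 < (c * 2 + 1) * B)%N = (r.*2.+1 < B)%N by lia.
  by have -> : ((c * 2 + 1) * B <= (c * B + r).*2)%N = (B <= r.*2)%N by lia.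
Qed.

(** There are [b./2] digits below the middle one and [b./2] above it; the middle digit keeps the
    slope [x]. *)
Lemma count_refine_slope (D : pred R) (x : R) : odd b ->
  count (fun u => D (refine_slope b u x)) (iota 0 b) =
  (D 1%R * b./2 + D x + D (-1)%R * b./2)%N.
Proof.
move=> ob; have bE : b = (b./2 + (1 + b./2))%N.
  by rewrite -{1}(odd_double_half b) ob; lia.
rewrite [X in iota _ X]bE iotaD count_cat add0n iotaD count_cat /= addn0.
rewrite addnA; congr (_ + _ + _)%N.
- rewrite (@eq_in_count _ _ (fun=> D 1%R)) => [|u]; last first.
    by rewrite mem_iota /refine_slope add0n /= => ->.
  by case: (D 1%R); rewrite ?count_predT ?count_pred0 ?size_iota ?mul1n.
- by rewrite /refine_slope ltnn.
- rewrite (@eq_in_count _ _ (fun=> D (-1)%R)) => [|u]; last first.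
    rewrite mem_iota /refine_slope => /andP[h _].
    by rewrite ltnNge ltnW/= ?ifT//; lia.
  by case: (D (-1)%R); rewrite ?count_predT ?count_pred0 ?size_iota ?mul1n.
Qed.

Lemma count_ltn_iota (h n : nat) : (h <= n)%N ->
  count (fun u => u < h)%N (iota 0 n) = h.
Proof.
move=> hn; rewrite -[X in iota _ X](subnKC hn) iotaD count_cat add0n.
rewrite (@eq_in_count _ _ predT) => [|u]; last by rewrite mem_iota add0n /= => ->.
rewrite (@eq_in_count _ _ pred0 (iota h _)) => [|u]; last first.
  by rewrite mem_iota => /andP[? _]; apply/negbTE; rewrite -leqNgt.
by rewrite count_predT count_pred0 size_iota addn0.
Qed.

End refinement.

Section bernoulli.
Context {d : measure_display} {T : measurableType d} {R : realType}.
Context (P : probability T R).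

(** The two atoms determine the law, so any two such variables are identically distributed. *)
Lemma symmetric_bernoulli_law (X : T -> R) (A : set R) :
  measurable_fun setT X -> symmetric_bernoulli P X ->
  P (X @^-1` A) =
  ((if -1 \in A then 2^-1 else 0)%:E + (if 1 \in A then 2^-1 else 0)%:E)%E.
Proof.
have N11 : (-1 : R) <> 1 by lra.
move=> mX [X1 PN PP].
have mpre c : measurable (X @^-1` [set c]).
  by rewrite -[X in measurable X]setTI; exact: mX.
pose F c : set T := if c \in A then X @^-1` [set c] else set0.
have mF c : measurable (F c) by rewrite /F; case: ifP.
have -> : X @^-1` A = F (-1) `|` F 1.
  apply/seteqP; split=> w; rewrite /F.
    by case: (X1 w) => /= Xw; rewrite Xw => /mem_set ->; [left|right].
  by move=> []; case: ifPn => // /set_mem Ac /= ->.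
have <- : P (F (-1)) = (if -1 \in A then 2^-1 else 0)%:E.
  by rewrite /F; case: ifP => // _; exact: measure0.
have <- : P (F 1) = (if 1 \in A then 2^-1 else 0)%:E.
  by rewrite /F; case: ifP => // _; exact: measure0.
apply: measureU => //; apply/seteqP; split=> // w []; rewrite /F.
by case: ifP => // _; case: ifP => // _ /= ->.
Qed.

End bernoulli.

Section slope_processes.
Context {d : measure_display} {T : measurableType d} {R : realType}.
Context (P : probability T R) (b : nat) (U : nat -> {RV P >-> nat}).
Context (b_gt0 : (0 < b)%N).
Context (U_indep : independent P (fun i => U i : T -> nat)).
Context (U_unif : forall i, uniform_digit P b (U i)).
Local Notation V := (fun i => U i : T -> nat).
Local Notation Y := (slope_process (@tent R) b V).

Let measurable_preU i A : measurable (U i @^-1` A).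
Proof. by rewrite -[_ @^-1` _]setTI; exact: (measurable_funPT (U i)). Qed.

Lemma measurable_slope_process m : measurable_fun setT (Y m).
Proof.
exact: (measurableT_comp (measurable_nat_fun _ _ _) (measurable_digit_sum P b U m)).
Qed.

Lemma slope_process_side m w :
  Y m w = side (b ^ m) (digit_sum V b m w %% b ^ m)%N.
Proof.
rewrite /slope_process -(slope_mod b b_gt0) slope_side// ltn_mod expn_gt0.
by rewrite b_gt0.
Qed.

Lemma slope_process_even m w : ~~ odd b -> (forall i, (U i w < b)%N) ->
  Y m.+1 w = if (U m w < b./2)%N then 1 else -1.
Proof.
move=> ob Uw; have lt k := digit_sum_lt V b w b_gt0 Uw k.
by rewrite slope_process_side modn_small// digit_sumS expnS side_even.
Qed.

Lemma slope_process_odd m w : odd b -> (forall i, (U i w < b)%N) ->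
  Y m.+1 w = refine_slope b (U m w) (Y m w).
Proof.
move=> ob Uw; have lt k := digit_sum_lt V b w b_gt0 Uw k.
by rewrite !slope_process_side !modn_small// digit_sumS expnS side_odd.
Qed.

(** Level 0 has the single interval [0,1], with tent value 0 at both ends. This gives a starting
    state before [Y 1]. *)
Lemma slope_process0 w : Y 0 w = 0.
Proof. by rewrite slope_process_side modn1. Qed.

Lemma symmetric_bernoulli_slope_process m : ~~ odd b ->
  symmetric_bernoulli P (Y m.+1).
Proof.
move=> ob; have mpre c : measurable (Y m.+1 @^-1` [set c]).
  by rewrite -[X in measurable X]setTI; exact: measurable_slope_process.
have b0 : b%:R != 0 :> R by rewrite pnatr_eq0 -lt0n.
have bE : b%:R = b./2%:R + b./2%:R :> R.
  by rewrite -natrD addnn even_halfK.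
have hb : (b./2 <= b)%N by lia.
have half : b./2%:R / b%:R = 2^-1 :> R.
  by apply: (mulIf b0); rewrite divfK// bE; lra.
split=> [w||].
(* The values must be signs at every [w], not just almost surely: reduction modulo [b ^ m.+1]
   handles all [w], and the value 0 would force this even power to be odd. *)
- rewrite slope_process_side /side; case: ifPn => h1; first by right.
  case: ifPn => h2; first by left.
  have := odd_double_half (b ^ m.+1); rewrite oddX (negbTE ob) /=; lia.
- rewrite (@eq_prob_digits _ _ _ P b U b_gt0 U_unif _
    (U m @^-1` [set k | predC (fun u => u < b./2)%N k]))//.
    rewrite (prob_digit P b U b_gt0 U_unif).
    have := count_predC (fun u => u < b./2)%N (iota 0 b).
    rewrite count_ltn_iota// size_iota => cb.
    by rewrite (_ : count _ _ = b./2) ?half//; lia.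
  move=> w Uw /=; rewrite slope_process_even//; case: ifP => _ //=.
  by split=> // ?; lra.
- rewrite (@eq_prob_digits _ _ _ P b U b_gt0 U_unif _
    (U m @^-1` [set k | (k < b./2)%N]))//.
    by rewrite (prob_digit P b U b_gt0 U_unif) count_ltn_iota// half.
  move=> w Uw /=; rewrite slope_process_even//; case: ifP => _ //=.
  by split=> // ?; lra.
Qed.

(** Almost surely each variable depends on its own digit only, so independence passes from the
    digits to [X]. The map [g] may vary with [i], which also covers slopes multiplied by
    deterministic signs. *)
Lemma iid_digit_signs (X : nat -> T -> R) (g : nat -> nat -> R) :
  (forall i, measurable_fun setT (X i)) ->
  (forall i, symmetric_bernoulli P (X i)) ->
  (forall w, (forall i, (U i w < b)%N) -> forall i, X i w = g i (U i w)) ->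
  iid P X.
Proof.
move=> mX bX Xg; split=> // [s A us mA|i j A mA]; last first.
  by rewrite /pushforward !symmetric_bernoulli_law.
have mpre i B : measurable B -> measurable (X i @^-1` B).
  by move=> mB; rewrite -[X in measurable X]setTI; exact: mX.
rewrite (@eq_prob_digits _ _ _ P b U b_gt0 U_unif _
    (\bigcap_(i in [set` s]) (U i @^-1` (g i @^-1` A i)))).
- rewrite (U_indep s (fun i => g i @^-1` A i))//; apply: eq_bigr => i _.
  apply: (eq_prob_digits P b U b_gt0 U_unif) => //; first exact: mpre.
  by move=> w Uw /=; rewrite Xg.
- by apply: bigcap_measurableType => i _; exact: mpre.
- by apply: bigcap_measurableType.
- by move=> w Uw; split=> h i /h /=; rewrite Xg.
Qed.

End slope_processes.

(** * The Markov chain *)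

Section markov.
Context {d : measure_display} {T : measurableType d} {R : realType}.
Context (P : probability T R) (b : nat) (U : nat -> {RV P >-> nat}).
Context (b_gt0 : (0 < b)%N).
Context (U_indep : independent P (fun i => U i : T -> nat)).
Context (U_unif : forall i, uniform_digit P b (U i)).
Context (b_odd : odd b).
Local Notation V := (fun i => U i : T -> nat).
Local Notation Y := (slope_process (@tent R) b V).
Local Notation st := (@tri_state R).

(* [0] is the value of the process at time [0], see [slope_process0]. *)
Definition path_before (x : nat -> 'I_3) k : R :=
  if k is k'.+1 then st (x k') else 0.

Definition path_digits (x : nat -> 'I_3) k : pred nat :=
  fun u => refine_slope b u (path_before x k) == st (x k).

Definition path_event (x : nat -> 'I_3) m : set T :=
  [set w | forall k, (k <= m)%N -> Y k.+1 w = st (x k)].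

Lemma measurable_path_event x m : measurable (path_event x m).
Proof.
rewrite (_ : path_event x m = \bigcap_(k in [set k | (k <= m)%N])
    (Y k.+1 @^-1` [set st (x k)])).
  apply: bigcap_measurableType => k _; rewrite -[X in measurable X]setTI.
  exact: measurable_slope_process.
by apply/seteqP; split=> w h k /h.
Qed.

(** Along a prescribed path the preceding slope is known, so the condition on slope [k + 1] concerns
    digit [k] alone. This yields a product event even though the slopes need not be independent. *)
Lemma path_event_digits x m w : (forall i, (U i w < b)%N) ->
  path_event x m w <-> forall k, (k <= m)%N -> path_digits x k (U k w).
Proof.
move=> Uw; have Yb k : (forall j, (j < k)%N -> Y j.+1 w = st (x j)) ->
    Y k w = path_before x k.
  by case: k => [_|k ->//]; rewrite slope_process0.
split=> h k km.
  apply/eqP; rewrite -Yb => [|j jk]; last by apply: h; rewrite ltnW// (leq_trans jk).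
  by rewrite -slope_process_odd// h.
(* The induction carries the whole path, because the refinement rule for the next slope needs the
   current one. *)
suff : forall j, (j < k.+1)%N -> Y j.+1 w = st (x j) by exact.
elim: k km => [|k ih] km j jk.
  move: jk; rewrite ltnS leqn0 => /eqP ->.
  by rewrite slope_process_odd// slope_process0//; apply/eqP; exact: (h 0%N).
have {}ih := ih (ltnW km).
move: jk; rewrite ltnS leq_eqVlt => /predU1P[->|/ih//].
rewrite slope_process_odd// (Yb k.+1 ih).
by apply/eqP; exact: (h k.+1).
Qed.

Lemma prob_path_event x m : P (path_event x m) =
  (\prod_(k < m.+1) ((count (path_digits x k) (iota 0 b))%:R / b%:R))%:E.
Proof.
rewrite -prodEFin.
under eq_bigr => k _ do rewrite -(prob_digit P b U b_gt0 U_unif k).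
rewrite -(prob_digits P U U_indep m.+1 (fun k => [set u | path_digits x k u])).
apply: (eq_prob_digits P b U b_gt0 U_unif).
- exact: measurable_path_event.
- apply: bigcap_measurableType => k _; rewrite -[X in measurable X]setTI.
  exact: (measurable_funPT (U k)).
- by move=> w Uw; rewrite path_event_digits//; split=> h k km; apply: h.
Qed.

Lemma ord3P (i : 'I_3) : [\/ i = 0, i = 1 | i = 2%:R].
Proof.
by case: i => -[|[|[|//]]] h; [apply: Or31|apply: Or32|apply: Or33]; apply: val_inj.
Qed.

Let bR : (b%:R : R) = 2 * b./2%:R + 1.
Proof. by rewrite -[in LHS](odd_double_half b) b_odd -mul2n natrD natrM addrC. Qed.

Lemma refine_slope_prob (i j : 'I_3) :
  (count (fun u => refine_slope b u (st i) == st j) (iota 0 b))%:R / b%:R =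
  @trans_mx R b i j.
Proof.
rewrite (count_refine_slope b (fun y => y == st j))// !natrD !natrM mxE.
have b0 : 0 <= (b./2%:R : R) by [].
have bn0 : 2 * b./2%:R + 1 != 0 :> R by rewrite gt_eqF//; lra.
have e1 : (1 == -1 :> R) = false by apply/negbTE/eqP; lra.
have e2 : (-1 == 1 :> R) = false by apply/negbTE/eqP; lra.
have e3 : (1 == 0 :> R) = false by apply/negbTE/eqP; lra.
have e4 : (0 == 1 :> R) = false by apply/negbTE/eqP; lra.
have e5 : (-1 == 0 :> R) = false by apply/negbTE/eqP; lra.
have e6 : (0 == -1 :> R) = false by apply/negbTE/eqP; lra.
have [->|->|->] := ord3P i; have [->|->|->] := ord3P j;
  rewrite /tri_state /= ?(eqxx, e1, e2, e3, e4, e5, e6) /= bR; field; rewrite ?bn0//.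
Qed.

Lemma markov_chain_slope_process :
  markov_chain P (fun m => Y m.+1) tri_state (init_row b) (trans_mx b).
Proof.
split.
- by move=> m; exact: measurable_slope_process.
- move=> m w; rewrite slope_process_side// /side.
  case: ifP => _; first by exists 2%:R.
  by case: ifP => _; [exists 0|exists 1].
- move=> i.
  have -> : Y 1 @^-1` [set st i] = path_event (fun=> i) 0.
    by apply/seteqP; split=> [w wi k|w /(_ 0%N)]; [rewrite leqn0 => /eqP ->|exact].
  rewrite prob_path_event big_ord1; congr EFin.
  (* The initial law is the row of the state 0, whose index is 1, because [Y 0] is 0. *)
  have := refine_slope_prob 1 i; rewrite /path_digits/=.
  rewrite {1}/tri_state /= => ->; rewrite !mxE.
  by have [->|->|->] := ord3P i.
- move=> m x j past past0; rewrite /cond_prob.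
  (* The path [x] continued by [j]: the joint event is again a path event. The two product formulas
     share all factors but the last, which is the transition probability. *)
  pose x' k := if (k <= m)%N then x k else j.
  have x'E k : (k <= m)%N -> x' k = x k by rewrite /x' => ->.
  have -> : Y m.+2 @^-1` [set st j] `&` past = path_event x' m.+1.
    apply/seteqP; split=> [w [/= Yj h] k|w h].
      rewrite leq_eqVlt => /predU1P[->|km]; last by rewrite x'E// h.
      by rewrite Yj /x' ltnn.
    split=> /=; first by rewrite h// /x' ltnn.
    by move=> k km; rewrite -x'E// h// ltnW.
  have pastE : past = path_event x m by [].
  have E : \prod_(k < m.+1) ((count (path_digits x' k) (iota 0 b))%:R / b%:R) =
      \prod_(k < m.+1) ((count (path_digits x k) (iota 0 b))%:R / b%:R) :> R.
    apply: eq_bigr => -[k km] _ /=; congr (_%:R / _); apply: eq_count => u.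
    rewrite /path_digits /path_before x'E//; case: k km => // k km.
    by rewrite x'E// ltnW.
  move: past0; rewrite pastE !prob_path_event.
  rewrite [\prod_(k < m.+2) _]big_ord_recr/= E => past0.
  rewrite mulrAC mulfV ?mul1r; last by apply: contra_neq past0 => ->.
  rewrite -refine_slope_prob; congr (_%:R / _); apply: eq_count => u.
  by rewrite /path_digits /= x'E// /x' ltnn.
Qed.

End markov.

(** * The Bernoulli convolution *)

Section slope_series.
Context {d : measure_display} {T : measurableType d} {R : realType}.
Context (P : probability T R) (b : nat) (alpha : R) (U : nat -> {RV P >-> nat}).
Context (b_ge2 : (2 <= b)%N) (alpha_bounds : b%:R^-1 < `|alpha| < 1).
Context (U_indep : independent P (fun i => U i : T -> nat)).
Context (U_unif : forall i, uniform_digit P b (U i)).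
Local Notation V := (fun i => U i : T -> nat).
Local Notation Y := (slope_process (@tent R) b V).
Local Notation a := (alpha * b%:R).
Local Notation q := (- (ln b%:R / ln `|alpha|)).

Let b_gt0 : (0 < b)%N. Proof. exact: ltnW. Qed.
Let a1 : 1 < `|a|. Proof. exact: scale_gt1. Qed.
Let q_ge1 : 1 <= q. Proof. exact: variation_exponent_ge1. Qed.
Let q_gt0 : 0 < q. Proof. exact: lt_le_trans q_ge1. Qed.

Definition slope_series (w : T) : R := limn (weighted_sum a (fun m => Y m w)).

Let Y_le1 w m : `|Y m w| <= 1. Proof. exact: slope_le1. Qed.

Lemma cvg_slope_series w :
  weighted_sum a (fun m => Y m w) n @[n --> \oo] --> slope_series w.
Proof. exact: is_cvg_weighted_sum. Qed.

(** The sum on the left stops at [n - 1], whereas [weighted_sum] includes [n]; the shift does not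
    affect the limit. *)
Lemma slope_seriesE w :
  limn (fun n => \sum_(1 <= m < n) a ^- m * Y m w) = slope_series w.
Proof. by apply: cvg_lim => //; rewrite -cvg_shiftS; exact: cvg_slope_series. Qed.

Lemma slope_series_bound w : `|slope_series w| <= tail_bound a 0.
Proof.
have := weighted_sum_lim a (fun m => Y m w) 0 a1 (Y_le1 w).
by rewrite [weighted_sum _ _ 0]/weighted_sum big_geq// subr0.
Qed.

Lemma measurable_weighted_sum n :
  measurable_fun setT (fun w => weighted_sum a (fun m => Y m w) n).
Proof.
apply: measurable_sum => m; apply: measurable_realfun.measurable_funM => //.
exact: measurable_slope_process.
Qed.

Lemma measurable_slope_series : measurable_fun setT slope_series.
Proof.
apply: (measurable_realfun.measurable_fun_cvg measurable_weighted_sum).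
by move=> w _; exact: cvg_slope_series.
Qed.

Lemma integrable_powR (X : T -> R) (c : R) : measurable_fun setT X ->
  (forall w, `|X w| <= c) -> P.-integrable setT (fun w => (`|X w| `^ q)%:E).
Proof.
move=> mX Xc; apply: (bounded_integrable P (fun w => `|X w| `^ q) (c `^ q)).
  apply: (measurableT_comp (measurable_realfun.measurable_powR q)).
  exact: measurableT_comp.
move=> w; rewrite ger0_norm ?powR_ge0//; apply: ge0_ler_powR => //.
- exact: ltW.
- by rewrite nnegrE (le_trans _ (Xc w)).
Qed.

(** [Y j] uses the index of level [j], the increment of [f] the index of level [N]; they agree
    modulo [b ^ j], which is all that the slope of level [j] sees. *)
Lemma weighted_sum_digit_sum N w :
  weighted_sum a ((slope (@tent R) b)^~ (digit_sum V b N w)) N =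
  weighted_sum a (fun m => Y m w) N.
Proof.
apply: eq_weighted_sum => j jN.
by rewrite /slope_process -(slope_mod b b_gt0) (digit_sum_modn V b w _ _ jN) slope_mod.
Qed.

(** The digit sum of level N is uniform modulo [b ^ N], so averages over indices are moments of the
    partial sums. These converge to the moment of the series, as the tail is bounded uniformly in
    [w]. *)
Lemma has_variation_slope_series t : 0 <= t <= 1 ->
  has_variation b (weierstrass alpha b (@tent R)) q t
    (t * \int[P]_w (`|slope_series w| `^ q)).
Proof.
apply: (has_variation_weierstrass b alpha b_ge2 alpha_bounds
  (fun N => \int[P]_w (`|weighted_sum a (fun m => Y m w) N| `^ q))) => [N|].
  rewrite (Rintegral_digit_sum P b U b_gt0 U_indep U_unif N); last first.
    move=> k; congr (`|_| `^ _); apply: eq_weighted_sum => j jN.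
    rewrite -(slope_mod b b_gt0 j (k %% _)) modn_dvdm ?slope_mod//.
    exact: dvdn_exp2l.
  by under eq_Rintegral do rewrite weighted_sum_digit_sum.
have [L L0 hL] := powR_lipschitz q (tail_bound a 0) q_ge1 (tail_bound_ge0 a 0 a1).
exists L => // N; apply: Rintegral_dist_le.
- apply: (integrable_powR _ (tail_bound a 0)); first exact: measurable_weighted_sum.
  by move=> w; exact: weighted_sum_bound.
- apply: (integrable_powR _ (tail_bound a 0)); first exact: measurable_slope_series.
  exact: slope_series_bound.
move=> w; apply: (le_trans (hL _ _ _ _)).
- by rewrite normr_ge0 weighted_sum_bound.
- by rewrite normr_ge0 slope_series_bound.
rewrite ler_wpM2l// (le_trans (ler_dist_dist _ _))// distrC.
exact: weighted_sum_lim.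
Qed.

Lemma scaled_slope_series_moment :
  `|a| `^ (- q) * fine 'E_P[fun w => `|a * slope_series w| `^ q] =
  \int[P]_w (`|slope_series w| `^ q).
Proof.
have mS : measurable_fun setT (fun w => a * slope_series w).
  by apply: measurable_realfun.measurable_funM => //; exact: measurable_slope_series.
rewrite unlock -/(Rintegral P setT (fun w => `|a * slope_series w| `^ q)).
rewrite -RintegralZl//; last first.
  apply: (integrable_powR _ (`|a| * tail_bound a 0) mS) => w.
  by rewrite normrM ler_wpM2l// slope_series_bound.
apply: eq_Rintegral => w _; rewrite (normrM a) powRM// mulrA.
rewrite -powRD ?addNr ?powRr0 ?mul1r//.
by rewrite eqxx/= gt_eqF// (lt_trans ltr01).
Qed.

Lemma symmetric_bernoulliN (X : T -> R) :
  symmetric_bernoulli P X -> symmetric_bernoulli P (fun w => - X w).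
Proof.
move=> [X1 PN PP].
have opp (c : R) : (fun w => - X w) @^-1` [set c] = X @^-1` [set - c].
  by apply/seteqP; split=> w /= => [<-|->]; rewrite opprK.
by split; rewrite ?opp ?opprK// => w; case: (X1 w) => ->; [right|left]; rewrite ?opprK.
Qed.

Lemma bernoulli_convolution_slope_series : ~~ odd b ->
  bernoulli_convolution (1 / (`|alpha| * b%:R))
    (pushforward P (fun w => a * slope_series w)).
Proof.
move=> b_even; have := inv_norm_lt1 a a1.
have aE : `|a| = `|alpha| * b%:R by rewrite normrM normr_nat.
rewrite aE => /andP[r0 r1]; split; first by rewrite div1r r1 andbT; lra.
have alpha0 : alpha != 0.
  by apply: contraTneq a1 => ->; rewrite mul0r normr0 -leNgt.
(* The parameter of the convolution is the inverse of [|a|], whereas the series has powers of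
   [a^-1]. The signs of these powers are absorbed into the Bernoulli variables, whose law is
   symmetric. *)
pose X m w := Num.sg alpha ^+ m * Y m.+1 w.
have sgX m : Num.sg alpha ^+ m = 1 \/ Num.sg alpha ^+ m = -1.
  elim: m => [|m ih]; first by left; rewrite expr0.
  rewrite exprS; case: sgrP alpha0 ih => [//|_ _|_ _].
    by rewrite mul1r.
  by rewrite mulN1r => -[->|->]; rewrite ?opprK; [right|left].
have bX m : symmetric_bernoulli P (X m).
  have bY := symmetric_bernoulli_slope_process P b U b_gt0 U_unif m b_even.
  rewrite /X; case: (sgX m) => ->; first by under eq_fun do rewrite mul1r.
  under eq_fun do rewrite mulN1r.
  exact: symmetric_bernoulliN.
have iX : iid P X.
  apply: (iid_digit_signs P b U b_gt0 U_indep U_unif X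
    (fun i u => Num.sg alpha ^+ i * if (u < b./2)%N then 1 else -1)) => //.
    move=> i; apply: measurable_realfun.measurable_funM => //.
    exact: measurable_slope_process.
  by move=> w Uw i; rewrite /X slope_process_even.
exists d, T, P, X; split=> // A mA; congr (pushforward P _ A).
apply/funext => w; apply/esym/cvg_lim => //.
have sgE : 1 / (`|alpha| * b%:R) * Num.sg alpha = a^-1.
  have b0 : b%:R != 0 :> R by rewrite pnatr_eq0 -lt0n.
  by case: sgrP (alpha0) => [->|_ ?|_ ?]; rewrite ?eqxx//; field; rewrite b0.
(* The factor [a] lowers the exponent by one, matching a convolution indexed from 0 with slopes
   indexed from 1. *)
rewrite (_ : (fun n => _) = fun n => a * weighted_sum a (fun m => Y m w) n).
  by apply: cvgM; [exact: cvg_cst|exact: cvg_slope_series].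
apply/funext => n; rewrite /weighted_sum big_add1/= mulr_sumr.
apply: eq_bigr => m _; rewrite /X mulrA -exprMn sgE -exprVn exprS !mulrA.
by rewrite mulfV ?mul1r ?exprVn// -normr_gt0 (lt_trans ltr01).
Qed.

End slope_series.

Theorem proposition3p2 (R : realType) (b : nat) (alpha : R)
    (d : measure_display) (T : measurableType d) (P : probability T R)
    (U : nat -> {RV P >-> nat})
    (hb : (2 <= b)%N)
    (halpha : b%:R^-1 < `|alpha| < 1)
    (hUind : independent P (fun i => U i : T -> nat))
    (hUunif : forall i, uniform_digit P b (U i)) :
  let phi : R -> R := tent in
  let f : R -> R := weierstrass alpha b phi in
  let Y : nat -> T -> R := slope_process phi b (fun i => U i : T -> nat) in
  (~~ odd b ->
    [/\ iid P (fun m => Y m.+1),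
        forall m, symmetric_bernoulli P (Y m.+1) &
        let Z : T -> R :=
          fun w => limn (fun n => \sum_(1 <= m < n) (alpha * b%:R) ^- m * Y m w) in
        let Zt : T -> R := fun w => alpha * b%:R * Z w in
        let q : R := - (ln b%:R / ln `|alpha|) in
        [/\ measurable_fun setT Zt,
            bernoulli_convolution (1 / (`|alpha| * b%:R)) (pushforward P Zt),
            P.-integrable setT (fun w => (`|Zt w| `^ q)%:E) &
            forall t : R, 0 <= t <= 1 ->
              has_variation b f q t
                (t * (`|alpha| * b%:R) `^ (- q) *
                 fine 'E_P[fun w => `|Zt w| `^ q])]]) /\
  (odd b ->
    markov_chain P (fun m => Y m.+1) tri_state (init_row b) (trans_mx b)).
Proof.
move=> phi f Y; have b_gt0 : (0 < b)%N by exact: ltnW.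
split=> [b_even|b_odd]; last exact: markov_chain_slope_process.
split=> [|m|Z Zt q]; last 1 first.
- have ZtE : Zt = fun w => alpha * b%:R * slope_series P b alpha U w.
    by apply/funext => w; rewrite /Zt /Z slope_seriesE.
  have mZt : measurable_fun setT Zt.
    rewrite ZtE; apply: measurable_realfun.measurable_funM => //.
    exact: measurable_slope_series.
  split=> //.
  + by rewrite ZtE; exact: bernoulli_convolution_slope_series.
  + apply: (integrable_powR P b alpha hb halpha Zt
      (`|alpha * b%:R| * tail_bound (alpha * b%:R) 0) mZt) => w.
    by rewrite ZtE normrM ler_wpM2l// slope_series_bound.
  + move=> t t01; rewrite ZtE -mulrA -(normr_nat R b) -normrM normr_nat.
    rewrite scaled_slope_series_moment//.
    exact: has_variation_slope_series.
(* The sign at level [i + 1] is read off from the digit [U i]. *)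
- apply: (iid_digit_signs P b U b_gt0 hUind hUunif _
    (fun _ u => if (u < b./2)%N then 1 else -1)) => [i|i|w Uw i].
  + exact: measurable_slope_process.
  + exact: symmetric_bernoulli_slope_process.
  + exact: slope_process_even.
- exact: symmetric_bernoulli_slope_process.
Qed.
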